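(* Let $\mathbb{F}$ be a field and let $p_1,p_2,p_3,p_4$ be split polynomials of degree $2$ with coefficients in $\mathbb{F}$. Then every endomorphism of an infinite-dimensional $\mathbb{F}$-vector space is a $(p_1,p_2,p_3,p_4)$-sum.
   Context: $\mathbb{F}$ is an arbitrary field. An endomorphism of a vector space $V$ is an $\mathbb{F}$-linear map $V\to V$; no topology is involved, and the (algebraic) dimension may be any infinite cardinal. A polynomial is split if all its roots lie in $\mathbb{F}$ (it is a product of polynomials of degree at most one over $\mathbb{F}$). For polynomials $p_1,\dots,p_n$ over $\mathbb{F}$, an endomorphism $u$ of a vector space $V$ is called a $(p_1,\dots,p_n)$-sum when there exist endomorphisms $u_1,\dots,u_n$ of $V$ such that $u=\sum_{k=1}^n u_k$ and $p_k(u_k)=0$ for all $k\in\{1,\dots,n\}$. *)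

(* Defs.v *)
From mathcomp Require Import all_boot all_algebra.

Set Implicit Arguments.
Unset Strict Implicit.
Unset Printing Implicit Defensive.

Import GRing.Theory.
Local Open Scope ring_scope.

(* [size q <= 2] means that [q] has degree at most one. *)
Definition split_poly (F : fieldType) (p : {poly F}) : Prop :=
  exists2 qs : seq {poly F},
    forall q, q \in qs -> (size q <= 2)%N & p = \prod_(q <- qs) q.

Definition finite_dimensional (F : fieldType) (V : lmodType F) : Prop :=
  exists (n : nat) (e : 'I_n -> V),
    forall v : V, exists c : 'I_n -> F, v = \sum_(i < n) c i *: e i.

Definition infinite_dimensional (F : fieldType) (V : lmodType F) : Prop :=
  ~ finite_dimensional V.

(* [poly_end p u] is the map [p(u)].  It is written out because the library
   has no algebra of endomorphisms of an arbitrary [lmodType]. *)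
Definition poly_end (F : fieldType) (V : lmodType F)
    (p : {poly F}) (u : {linear V -> V}) : V -> V :=
  fun x => \sum_(i < size p) p`_i *: iter i u x.

Definition is_poly_sum (F : fieldType) (V : lmodType F) (n : nat)
    (ps : n.-tuple {poly F}) (u : {linear V -> V}) : Prop :=
  exists us : 'I_n -> {linear V -> V},
    (u =1 fun x => \sum_(k < n) us k x) /\
    (forall k : 'I_n, poly_end (tnth ps k) (us k) =1 fun=> 0).

(* Main.v *)
(* After subtracting scalars from the summands, it is enough to write any [u] as
   [u1 + u2 + u3 + u4] with [ui^2 = ci ui] for given scalars [ci]; every product
   [L R] with [R L = c id] satisfies that equation.  Zorn's lemma applied to
   sets of sequences gives a basis of [V] indexed by [S * nat], since a maximal
   free set of sequences spans a subspace of finite codimension, and the missing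
   vectors can be prepended to one of the sequences.  Hence [V] is isomorphic to
   [V * V] and endomorphisms become 2x2 block matrices of endomorphisms of [V].
   One can choose [u1] and [u2] to have arbitrary entries at [(1,2)] and [(2,1)]
   respectively, and [c1] or [c2] at [(2,2)] as their only other entry, so only
   the diagonal blocks [A] and [D] of [u] matter.  With [ai], [bi] the injections
   and projections of the splitting, [u3] and [u4] can be given the diagonals
   [(Y, c3 - Y)] and [(X, a1 (c4 - X) b1)]; what remains is [Y = A - X] and an
   equation [X = N + a1 X b1], which is solvable because the splitting makes [b1]
   locally nilpotent. *)
From HB Require Import structures.
Require Import Defs.
From mathcomp Require Import all_boot all_algebra.
From mathcomp Require Import ring.
From mathcomp Require Import boolp classical_sets.

Set Implicit Arguments.
Unset Strict Implicit.
Unset Printing Implicit Defensive.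

Import GRing.Theory.
Local Open Scope ring_scope.

(** * Subspaces and the adjunction of finitely many vectors *)

Section FreeFamilies.
Variables (F : fieldType) (V : lmodType F).

Definition subspace (U : V -> Prop) :=
  U 0 /\ forall (a : F) x y, U x -> U y -> U (a *: x + y).

(** The span of [U] and [x]; folded over a list, it expresses finite codimension without quotient
    spaces. *)
Definition add_line (x : V) (U : V -> Prop) : V -> Prop :=
  fun y => exists c : F, U (y - c *: x).

Lemma subspaceD U x y : subspace U -> U x -> U y -> U (x + y).
Proof. by case=> _ Ul Ux Uy; rewrite -[x]scale1r; apply: Ul. Qed.

Lemma subspaceZ U (a : F) x : subspace U -> U x -> U (a *: x).
Proof. by case=> U0 Ul Ux; rewrite -[_ *: _]addr0; apply: Ul. Qed.

Lemma add_line_subspace x U : subspace U -> subspace (add_line x U).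
Proof.
case=> U0 Ul; split=> [|a y z [c Uc] [d Ud]]; first by exists 0; rewrite scale0r subr0.
exists (a * c + d).
have -> : a *: y + z - (a * c + d) *: x = a *: (y - c *: x) + (z - d *: x).
  by rewrite scalerBr scalerA scalerDl opprD addrACA.
exact: Ul.
Qed.

Lemma sub_add_line x U y : U y -> add_line x U y.
Proof. by exists 0; rewrite scale0r subr0. Qed.

Lemma mem_add_line x U : subspace U -> add_line x U x.
Proof. by case=> U0 _; exists 1; rewrite scale1r subrr. Qed.

Lemma add_lines_subspace w U : subspace U -> subspace (foldr add_line U w).
Proof. by move=> Us; elim: w => //= x w; apply: add_line_subspace. Qed.

Lemma add_lines_mono w (U U' : V -> Prop) y :
  (forall z, U z -> U' z) -> foldr add_line U w y -> foldr add_line U' w y.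
Proof.
move=> sUU'; elim: w y => [|x w IHw] y /=; first exact: sUU'.
by case=> c /IHw Uc; exists c.
Qed.

Lemma finite_dimensional_add_lines w (U : V -> Prop) :
  (forall z, U z -> z = 0) -> (forall y, foldr add_line U w y) ->
  finite_dimensional V.
Proof.
move=> U0 Uw; exists (size w), (fun i => w`_i) => v.
elim: w v {Uw}(Uw v) => [|x w IHw] v /=.
  by move/U0->; exists (fun=> 0); rewrite big_ord0.
case=> c /IHw[d Dv]; exists (fun i => oapp d c (unlift ord0 i)).
rewrite big_ord_recl unlift_none /=.
under eq_bigr => i _ do rewrite liftK /=.
by rewrite -Dv addrC subrK.
Qed.

(** * Linear combinations, free families and bases *)

Section Families.
Variable K : Type.
Implicit Types (D : set K) (e f h : K -> V) (l : seq (F * K)).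

Definition comb e l : V := \sum_(a <- l) a.1 *: e a.2.

(** The cut-off to 0 outside [D] lets a single index type serve all the sets compared by Zorn's
    lemma. *)
Definition restr D h : K -> V := fun k => if `[< D k >] then h k else 0.

Definition span D e : V -> Prop := fun v => exists l, v = comb (restr D e) l.

(* Freeness stated without coefficients being unique or indices being distinct:
   every linear relation between the [e k], [k \in D], holds for all families. *)
Definition free D e :=
  forall l, comb (restr D e) l = 0 -> forall f, comb (restr D f) l = 0.

Lemma comb_cons h a k l : comb h ((a, k) :: l) = a *: h k + comb h l.
Proof. by rewrite /comb big_cons. Qed.

Lemma comb_cat h l1 l2 : comb h (l1 ++ l2) = comb h l1 + comb h l2.
Proof. by rewrite /comb big_cat. Qed.

Lemma combZ h c l : comb h [seq (c * a.1, a.2) | a <- l] = c *: comb h l.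
Proof.
by rewrite /comb big_map scaler_sumr; apply: eq_bigr => a _; rewrite scalerA.
Qed.

Lemma eq_comb h h' l : h =1 h' -> comb h l = comb h' l.
Proof. by move=> eqh; apply: eq_bigr => a _; rewrite eqh. Qed.

Lemma span_subspace D e : subspace (span D e).
Proof.
split=> [|a _ _ [l1 ->] [l2 ->]]; first by exists [::]; rewrite /comb big_nil.
by exists ([seq (a * b.1, b.2) | b <- l1] ++ l2); rewrite comb_cat combZ.
Qed.

Lemma mem_span D e k : D k -> span D e (e k).
Proof.
move=> Dk; exists [:: (1, k)].
by rewrite /comb big_seq1 scale1r /restr asboolT.
Qed.

Definition basis D e := free D e /\ forall v, span D e v.

(** Coordinate lists are chosen without uniqueness; freeness makes the value of [g] independent of
    the choice, hence linear. *)
Lemma basis_linear D e f : basis D e ->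
  exists g : {linear V -> V}, forall k, D k -> g (e k) = f k.
Proof.
case=> free_e /choice[coord coordE].
pose g v := comb (restr D f) (coord v).
have gE l : g (comb (restr D e) l) = comb (restr D f) l.
  apply/eqP; rewrite -subr_eq0 addrC -scaleN1r -combZ -comb_cat.
  apply/eqP/free_e.
  by rewrite comb_cat combZ -coordE scaleN1r addNr.
have glin : linear g.
  move=> a x y; rewrite {1}(coordE x) {1}(coordE y) -combZ -comb_cat gE.
  by rewrite comb_cat combZ.
pose gL := GRing.isLinear.Build F V V *:%R g glin.
exists (HB.pack g gL : {linear V -> V}) => k Dk /=.
have -> : e k = comb (restr D e) [:: (1, k)].
  by rewrite /comb big_seq1 scale1r /restr asboolT.
by rewrite gE /comb big_seq1 scale1r /restr asboolT.
Qed.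

Lemma basis_eq D e (g g' : {linear V -> V}) : basis D e ->
  (forall k, D k -> g (e k) = g' (e k)) -> g =1 g'.
Proof.
case=> _ span_e eqg v; case: (span_e v) => l ->.
rewrite /comb !linear_sum; apply: eq_bigr => -[a k] _ /=.
by rewrite !linearZ /restr; case: asboolP => [/eqg->|_] //; rewrite !linear0.
Qed.

End Families.

(** * Families made of sequences, and prepending a vector to one of them *)

Section Sequences.
Variable I : choiceType.
Implicit Types (S : set I) (e : I * nat -> V).

Definition rows S : set (I * nat) := fun k => S k.1.

Definition prepend (i0 : I) (x : V) e : I * nat -> V := fun k =>
  if k.1 == i0 then (if k.2 is n.+1 then e (i0, n) else x) else e k.

(** [c] collects the coefficients at [(i0, 0)], and [l'] lowers the other indices of row [i0] by
    one. Both depend only on [l], so a relation can be carried from one family to another. *)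
Lemma comb_prepend S i0 l : S i0 -> exists c l', forall x e,
  comb (restr (rows S) (prepend i0 x e)) l
    = c *: x + comb (restr (rows S) e) l'.
Proof.
move=> Si0; elim: l => [|[a [i n]] l [c [l' IHl]]].
  by exists 0, [::] => x e; rewrite /comb !big_nil scale0r addr0.
have [-> | ni] := eqVneq i i0; last first.
  exists c, ((a, (i, n)) :: l') => x e; rewrite !comb_cons IHl addrCA.
  by congr (_ + (_ *: _ + _)); rewrite /restr /prepend /= (negPf ni).
case: n => [|n]; last first.
  exists c, ((a, (i0, n)) :: l') => x e; rewrite !comb_cons IHl addrCA.
  by rewrite /restr /prepend /= !eqxx.
exists (a + c), l' => x e; rewrite !comb_cons IHl addrA scalerDl.
by rewrite /restr /prepend /= eqxx asboolT.
Qed.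

Lemma free_prepend S i0 x e : S i0 -> free (rows S) e ->
  ~ span (rows S) e x -> free (rows S) (prepend i0 x e).
Proof.
move=> Si0 free_e nx l /[swap] f; have [c [l' lE]] := comb_prepend l Si0.
(* Any target family [f] is itself a prepended one, with head [f (i0, 0)] and tail [h]. *)
pose h k := if k.1 == i0 then f (i0, k.2.+1) else f k.
have fE : f =1 prepend i0 (f (i0, 0%N)) h.
  case=> i n; rewrite /prepend /h /=.
  by case: (eqVneq i i0) => [->|_] //; case: n => *; rewrite ?eqxx.
rewrite lE => Dl.
have c0 : c = 0.
  apply/eqP/negP => /negP nzc; apply: nx.
  exists [seq (- c^-1 * a.1, a.2) | a <- l']; rewrite combZ.
  move/eqP: Dl; rewrite addrC addr_eq0 => /eqP->.
  by rewrite scaleNr scalerN opprK scalerA mulVf ?scale1r.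
move: Dl; rewrite c0 scale0r add0r => /free_e Dl.
rewrite -(eq_comb (h := restr (rows S) (prepend i0 (f (i0, 0%N)) h))).
  by rewrite lE c0 scale0r add0r Dl.
by move=> k; rewrite /restr -fE.
Qed.

Lemma span_prepend S i0 x e y : S i0 ->
  span (rows S) e y -> span (rows S) (prepend i0 x e) y.
Proof.
move=> Si0 [l ->]; rewrite /comb; elim: l => [|[a [i n]] l IHl].
  by rewrite big_nil; case: (span_subspace (rows S) (prepend i0 x e)).
rewrite big_cons; case: (span_subspace (rows S) (prepend i0 x e)) => S0 Sl.
apply: Sl => //=; rewrite /restr; case: asboolP => // Si.
pose k := if i == i0 then (i0, n.+1) else (i, n).
have -> : e (i, n) = prepend i0 x e k.
  by rewrite /prepend /k; have [->|ni] := eqVneq i i0; rewrite /= ?eqxx ?(negPf ni).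
by apply: mem_span; rewrite /rows /k; case: (i == i0).
Qed.

(** Induction on [w]: a vector already in the span is dropped, any other is put in front of row
    [i0]. *)
Lemma basis_prepend S i0 w e : S i0 -> free (rows S) e ->
    (forall y, foldr add_line (span (rows S) e) w y) ->
  exists e', basis (rows S) e'.
Proof.
move=> Si0; elim: w e => [|x w IHw] e free_e /= spanw; first by exists e.
have [ex | nx] := EM (span (rows S) e x).
  apply: (IHw e) => // y; have [c yE] := spanw y.
  rewrite -(subrK (c *: x) y); set Sp := span _ _ in yE ex *.
  have Ss : subspace Sp by apply: span_subspace.
  apply: subspaceD yE _; first exact: add_lines_subspace.
  apply: subspaceZ; first exact: add_lines_subspace.
  by elim: (w) => //= z w' ?; apply: sub_add_line.
apply: (IHw (prepend i0 x e)); first exact: free_prepend.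
set Sp := span _ (prepend _ _ _).
have Ss : subspace Sp by apply: span_subspace.
move=> y; have [c yE] := spanw y.
rewrite -(subrK (c *: x) y); apply: subspaceD.
- exact: add_lines_subspace.
- by apply: add_lines_mono yE => z; apply: span_prepend.
apply: subspaceZ; first exact: add_lines_subspace.
have Spx : Sp x.
  have -> : x = prepend i0 x e (i0, 0%N) by rewrite /prepend eqxx.
  exact: mem_span.
by elim: (w) => //= z w' ?; apply: sub_add_line.
Qed.

End Sequences.
End FreeFamilies.

Arguments add_line {F V} x U _.

(** * Existence of a basis made of sequences, by Zorn's lemma *)

Section Existence.
Variables (F : fieldType) (V : lmodType F).

Lemma free_bigcup (I : choiceType) (e : I * nat -> V) (C : set (set I)) :
  (forall S, C S -> free (rows S) e) -> total_on C subset ->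
  free (rows (\bigcup_(S in C) S)%classic) e.
Proof.
move=> freeC totC l; set U := (\bigcup_(S in C) S)%classic.
have [[T0 CT0] | C0] := pselect (exists T, C T); last first.
  move=> _ f; rewrite /comb big1 // => -[a k] _ /=.
  by rewrite /restr asboolF ?scaler0 // => -[T CT]; case: C0; exists T.
(* The finitely many indices of [l] in the union lie in one member of the chain; allowing all larger
   [T'] makes the induction on [l] go through. *)
have [T CT TE] : exists2 T, C T & forall T', C T' -> (T `<=` T')%classic ->
    forall h, comb (restr (rows U) h) l = comb (restr (rows T') h) l :> V.
  elim: l => [|[a k] l [T CT IHl]].
    by exists T0 => // T' _ _ h; rewrite /comb !big_nil.
  have [[T1 CT1 T1k] | nUk] := pselect (rows U k); last first.
    exists T => // T' CT' TT' h; rewrite !comb_cons (IHl T' CT' TT').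
    rewrite /restr asboolF // asboolF // => T'k.
    by apply: nUk; exists T'.
  have [T2 CT2 [TT2 T12]] : exists2 T2, C T2 & (T `<=` T2 /\ T1 `<=` T2)%classic.
    by have [?|?] := totC _ _ CT CT1; [exists T1 | exists T]; do ?split.
  exists T2 => // T' CT' TT' h; rewrite !comb_cons (IHl T' CT'); last first.
    exact: subset_trans TT'.
  rewrite /restr asboolT; last by exists T1.
  by rewrite asboolT //; apply/TT'/T12.
by rewrite (TE T) // => /(freeC T CT) le0 f; rewrite (TE T).
Qed.

(** In a relation modulo [U], the largest index [n] with nonzero total coefficient would put
    [pick (L n)] in the span of [U] and [L n]. *)
Lemma free_sequence (U : V -> Prop) (pick : seq V -> V) (L : nat -> seq V) :
    subspace U -> (forall w, ~ foldr add_line U w (pick w)) ->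
    (forall n, L n.+1 = pick (L n) :: L n) ->
  forall l, U (comb (fun n => pick (L n)) l) ->
  forall f : nat -> V, comb f l = 0.
Proof.
move=> Us pickN LS l Ul f.
have memL m n : (m < n)%N -> foldr add_line U (L n) (pick (L m)).
  elim: n => // n IHn; rewrite ltnS leq_eqVlt LS /= => /predU1P[->|/IHn mn].
    by apply/mem_add_line/add_lines_subspace.
  exact: sub_add_line.
have [N lN] : exists N, all (fun a => a.2 < N)%N l.
  exists (\max_(a <- l) a.2).+1; apply/allP => a al.
  by rewrite ltnS; exact: (leq_bigmax_seq (F := fun a : F * nat => a.2)).
elim: N l lN Ul => [|n IHn] l lN.
  case: l lN => [|a l] //= _ _; exact: big_nil.
have lE h : comb h l = (\sum_(a <- l | a.2 == n) a.1) *: h n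
    + comb h [seq a <- l | a.2 != n].
  rewrite /comb (bigID (fun a : F * nat => a.2 == n)) /= big_filter; congr (_ + _).
  by rewrite scaler_suml; apply: eq_bigr => a /eqP->.
have ln : all (fun a => a.2 < n)%N [seq a <- l | a.2 != n].
  rewrite all_filter; apply: sub_all lN => a /= an; apply/implyP => nan.
  by rewrite ltn_neqAle nan -ltnS.
rewrite !lE; set c := \sum_(a <- l | _) _.
have [->|nzc] := eqVneq c 0; first by rewrite !scale0r !add0r => /IHn->.
set l' := [seq a <- l | _] in ln *; move=> Uc.
have Uns := add_lines_subspace (L n) Us.
have Ul' : foldr add_line U (L n) (comb (fun n => pick (L n)) l').
  rewrite /comb; elim: l' ln {Uc} => [|a l' IHl] /=.
    by rewrite big_nil; case: Uns.
  case/andP=> an l'n; rewrite big_cons; case: (Uns) => _; apply.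
    exact: memL.
  exact: IHl.
have U_Un y : U y -> foldr add_line U (L n) y.
  by move=> Uy; elim: (L n) => //= x w IHw; apply: sub_add_line.
case: (pickN (L n)).
have -> : pick (L n) = c^-1 *: (c *: pick (L n)
    + comb (fun n => pick (L n)) l' + (-1) *: comb (fun n => pick (L n)) l').
  by rewrite scaleN1r addrK scalerA mulVf ?scale1r.
apply: subspaceZ => //; apply: subspaceD => //; first exact: U_Un.
exact: subspaceZ.
Qed.

Lemma exists_sequence_basis : infinite_dimensional V ->
  exists (I : choiceType) (S : set I) (i0 : I) (e : I * nat -> V),
    S i0 /\ basis (rows S) e.
Proof.
move=> infV; pose e (k : (nat -> V) * nat) := k.1 k.2.
have [S [freeS maxS]] := @Zorn_bigcup (nat -> V)
  (fun S => free (rows S) e) (fun C => @free_bigcup (nat -> V : choiceType) e C).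
have Ss := span_subspace (rows S) e.
have [[w spanw] | nfin] := pselect (exists w, forall y,
    foldr add_line (span (rows S) e) w y).
  (* An empty [S] would span 0 and make [V] finite-dimensional, so some row can receive the missing
     vectors. *)
  have [[s0 Ss0] | S0] := pselect (exists s, S s).
    have [e' e'S] := basis_prepend Ss0 freeS spanw.
    by exists ((nat -> V) : choiceType), S, s0, e'.
  case: infV; apply: (finite_dimensional_add_lines _ spanw) => _ [l ->].
  rewrite /comb big1 // => -[a k] _ /=.
  by rewrite /restr asboolF ?scaler0 // => Sk; case: S0; exists k.1.
(* In infinite codimension, greedy picking gives a sequence [v] free modulo the span of [S];
   adjoining it contradicts maximality. *)
have /choice[pick pickN] : forall w, exists y,
    ~ foldr add_line (span (rows S) e) w y.
  move=> w; apply: contra_notP nfin => /forallNP spanw.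
  by exists w => y; apply: contrapT.
pose L := fix L n := if n is n'.+1 then pick (L n') :: L n' else [::].
pose v n := pick (L n).
have nSv : ~ S v.
  by move=> Sv; apply: (pickN [::]); apply: (@mem_span _ _ _ _ e (v, 0%N)).
pose S' : set (nat -> V) := fun s => S s \/ s = v.
case: (maxS S').
  split; first by move=> s Ss0; left.
  by move=> /(_ v) S'S; apply/nSv/S'S; right.
move=> l.
have [l1 [l2 lE]] : exists l1 l2, forall h : (nat -> V) * nat -> V,
    comb (restr (rows S') h) l
      = comb (fun n => h (v, n)) l1 + comb (restr (rows S) h) l2.
  elim: l => [|[a [s n]] l [l1 [l2 lE]]].
    by exists [::], [::] => h; rewrite /comb !big_nil addr0.
  have [-> | sv] := pselect (s = v).
    exists ((a, n) :: l1), l2 => h; rewrite !comb_cons lE addrA.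
    by rewrite {1}/restr asboolT //; right.
  exists l1, ((a, (s, n)) :: l2) => h; rewrite !comb_cons lE addrCA.
  rewrite /restr; have [Ss0|nSs] := pselect (S s).
    by rewrite !asboolT //; left.
  by rewrite !asboolF // => -[].
rewrite lE => le0 f.
have l10 (h : nat -> V) : comb h l1 = 0.
  apply: (free_sequence Ss pickN (L := L)) => //.
  exists [seq (-1 * a.1, a.2) | a <- l2]; rewrite combZ scaleN1r.
  by apply/eqP; rewrite -addr_eq0; apply/eqP.
move: le0; rewrite !lE !l10 !add0r => /freeS; exact.
Qed.

End Existence.

(** * Block decomposition into four quadratic summands *)

Section FourQuadratic.
Variables (F : fieldType) (V : lmodType F).

(* On the basis rows, [a1] and [a2] send the [n]-th vector to the
   [n.*2.+1]-st and the [n.*2]-nd; as [n < n.*2.+1], [b1] is locally nilpotent,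
   which makes the equation for [X] solvable by recursion on [n]. *)
Lemma exists_splitting : infinite_dimensional V ->
  exists a1 a2 b1 b2 : {linear V -> V},
    [/\ cancel a1 b1, cancel a2 b2, forall x, b1 (a2 x) = 0,
        forall x, b2 (a1 x) = 0 & forall x, x = a1 (b1 x) + a2 (b2 x)]
    /\ forall N : {linear V -> V}, exists X : {linear V -> V},
         forall x, X x = N x + a1 (X (b1 x)).
Proof.
move/exists_sequence_basis=> [I [S [i0 [e [_ be]]]]].
have [a1 a1E] := basis_linear (fun k => e (k.1, k.2.*2.+1)) be.
have [a2 a2E] := basis_linear (fun k => e (k.1, k.2.*2)) be.
have [b1 b1E] := basis_linear
  (fun k => if odd k.2 then e (k.1, k.2./2) else 0) be.
have [b2 b2E] := basis_linear
  (fun k => if odd k.2 then 0 else e (k.1, k.2./2)) be.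
have ext (g g' : {linear V -> V}) :
    (forall i n, S i -> g (e (i, n)) = g' (e (i, n))) -> g =1 g'.
  by move=> gg'; apply: basis_eq be _ => -[i n]; apply: gg'.
exists a1, a2, b1, b2; split; first split.
- apply: (ext (b1 \o a1) idfun) => i n Si /=.
  by rewrite a1E // b1E //= odd_double /= uphalf_double.
- apply: (ext (b2 \o a2) idfun) => i n Si /=.
  by rewrite a2E // b2E //= odd_double /= doubleK.
- apply: (ext (b1 \o a2) \0) => i n Si /=.
  by rewrite a2E // b1E //= odd_double.
- apply: (ext (b2 \o a1) \0) => i n Si /=.
  by rewrite a1E // b2E //= odd_double.
- apply: (ext idfun ((a1 \o b1) \+ (a2 \o b2))) => i n Si /=.
  rewrite b1E // b2E //=; have := odd_double_half n.
  case: (odd n) => /= nE; rewrite linear0 ?addr0 ?add0r.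
    by rewrite a1E //= -[in LHS]nE.
  by rewrite a2E //= -[in LHS]nE.
move=> N.
(* [x i m n] is the intended [X (e (i, n))] with fuel [m]: halving an odd [n] decreases it, so every
   [m > n] gives the same value. *)
pose x i := fix x m n : V :=
  if m is m'.+1 then N (e (i, n)) + (if odd n then a1 (x m' n./2) else 0) else 0.
have xE i m n : x i m.+1 n = N (e (i, n)) + (if odd n then a1 (x i m n./2) else 0).
  by [].
clearbody x.
have xS i m n : (n < m)%N -> x i m n = x i n.+1 n.
  elim/ltn_ind: n m => n IHn [//|m]; rewrite ltnS !xE => nm.
  case on: (odd n) => //.
  have n0 : (0 < n)%N by case: (n) on.
  have n2 : (n./2 < n)%N by rewrite ltn_half_double -addnn -[ltnLHS]addn0 ltn_add2l.
  by rewrite (IHn _ n2) ?(IHn _ n2 n) // (leq_trans n2).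
have [X XE] := basis_linear (fun k => x k.1 k.2.+1 k.2) be.
exists X; apply: (ext X (N \+ (a1 \o (X \o b1)))) => i n Si /=.
rewrite XE //= xE b1E //=; case on: (odd n); last by rewrite !linear0.
have n0 : (0 < n)%N by case: (n) on.
rewrite XE //= -(xS i n) // ltn_half_double -addnn -[ltnLHS]addn0.
by rewrite ltn_add2l.
Qed.

Lemma comp_quadratic (c : F) (L R : V -> V) :
  (forall x, R (L x) = c *: x) -> scalable L ->
  forall x, L (R (L (R x))) = c *: L (R x).
Proof. by move=> RL Ls x; rewrite RL Ls. Qed.

Lemma sum_four_quadratic (c1 c2 c3 c4 : F) (u : {linear V -> V}) :
  infinite_dimensional V ->
  exists u1 u2 u3 u4 : {linear V -> V},
    [/\ forall x, u1 (u1 x) = c1 *: u1 x, forall x, u2 (u2 x) = c2 *: u2 x,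
        forall x, u3 (u3 x) = c3 *: u3 x & forall x, u4 (u4 x) = c4 *: u4 x]
    /\ forall x, u x = u1 x + u2 x + u3 x + u4 x.
Proof.
case/exists_splitting=> a1 [a2 [b1 [b2 [[b1a1 b2a2 b1a2 b2a1 dec] solve]]]].
(* The equation for [X] says that [u - u3 - u4] has [(2,2)] block [c1 + c2]. *)
have [X XE] := solve ((b2 \o (u \o a2)) \+ (b1 \o (u \o a1))
  \- ((c1 + c2 + c3) \*: idfun) \- (c4 \*: (a1 \o b1))).
pose Y : {linear V -> V} := (b1 \o (u \o a1)) \- X.
have YE y : Y y = b1 (u (a1 y)) - X y by [].
clearbody Y.
(* [L3], [L4] are the columns [(1, c3 - Y)], [(1, a1 (c4 - X))] and [R3], [R4] the rows [(Y, 1)],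
   [(X, b1)]. As [b1 a1 = 1], the products [R3 L3] and [R4 L4] are the scalars [c3] and [c4]. *)
pose L3 : {linear V -> V} := a1 \+ (a2 \o ((c3 \*: idfun) \- Y)).
pose R3 : {linear V -> V} := (Y \o b1) \+ b2.
pose L4 : {linear V -> V} := a1 \+ (a2 \o (a1 \o ((c4 \*: idfun) \- X))).
pose R4 : {linear V -> V} := (X \o b1) \+ (b1 \o b2).
pose d : {linear V -> V} := u \- (L3 \o R3) \- (L4 \o R4).
have b1L3 y : b1 (L3 y) = y by rewrite /= linearD b1a1 b1a2 addr0.
have b2L3 y : b2 (L3 y) = c3 *: y - Y y by rewrite /= linearD b2a1 b2a2 add0r.
have R3a1 y : R3 (a1 y) = Y y by rewrite /= b1a1 b2a1 addr0.
have R3a2 y : R3 (a2 y) = y by rewrite /= b1a2 b2a2 linear0 add0r.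
have b1L4 y : b1 (L4 y) = y by rewrite /= linearD b1a1 b1a2 addr0.
have b2L4 y : b2 (L4 y) = a1 (c4 *: y - X y).
  by rewrite /= linearD b2a1 b2a2 add0r.
have R4a1 y : R4 (a1 y) = X y by rewrite /= b1a1 b2a1 linear0 addr0.
have R4a2 y : R4 (a2 y) = b1 y by rewrite /= b1a2 b2a2 linear0 add0r.
have dE y : d y = u y - L3 (R3 y) - L4 (R4 y) by [].
clearbody d L3 R3 L4 R4.
have d11 x : b1 (d (a1 x)) = 0.
  by rewrite dE 2!linearB b1L3 b1L4 R3a1 R4a1 YE opprB addrCA subrr addr0 subrr.
have d22 x : b2 (d (a2 x)) = (c1 + c2) *: x.
  rewrite dE 2!linearB b2L3 b2L4 R3a2 R4a2 YE XE /= (linearB a1) [a1 (c4 *: _)]linearZ /=.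
  rewrite scalerDl !opprB !opprD !opprK !addrA.
  move: (b2 _) (b1 _) (_ *: x) (c3 *: x) (c4 *: _) (a1 _) => D A C E P Q.
  by rewrite [LHS](ACl (5*1*3*2*4*6*9*7*11*10*8)) /= !addrK.
(* The remainder [d] has diagonal [(0, c1 + c2)]: [L1 b2] takes its second column with [c1] at the
   corner, [a2 R2] its second row with [c2] there. *)
pose L1 : {linear V -> V} := (a1 \o (b1 \o (d \o a2))) \+ (c1 \*: a2).
pose R2 : {linear V -> V} := (b2 \o (d \o (a1 \o b1))) \+ (c2 \*: b2).
exists (L1 \o b2), (a2 \o R2), (L3 \o R3), (L4 \o R4); split; first split.
- apply: comp_quadratic => [x|a x]; last exact: linearZ.
  by rewrite /= linearD linearZ /= b2a1 b2a2 add0r.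
- apply: comp_quadratic => [x|a x]; last exact: linearZ.
  by rewrite /= b1a2 !linear0 add0r b2a2.
- apply: comp_quadratic => [x|a x]; last exact: linearZ.
  by rewrite [L3 x]dec linearD R3a1 R3a2 b1L3 b2L3 addrC subrK.
- apply: comp_quadratic => [x|a x]; last exact: linearZ.
  by rewrite [L4 x]dec linearD R4a1 R4a2 b1L4 b2L4 b1a1 addrC subrK.
move=> x; have -> : u x = d x + L3 (R3 x) + L4 (R4 x) by rewrite dE addrAC subrK subrK.
congr (_ + _ + _); rewrite {1}[x]dec linearD.
rewrite [d (a1 _)]dec d11 [d (a2 (b2 x))]dec d22.
rewrite /= !linearD !linearZ /= linear0 add0r scalerDl addrC -!addrA.
by congr (_ + (_ + _)); rewrite addrC.
Qed.

End FourQuadratic.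

(** * From split quadratic polynomials to the equations [v^2 = c v] *)

(** Constant factors only rescale the product, so some factor has degree one and hence a root. *)
Lemma prod_root (F : fieldType) (qs : seq {poly F}) :
  (forall q, q \in qs -> (size q <= 2)%N) ->
  (1 < size (\prod_(q <- qs) q)%R)%N -> exists a, root (\prod_(q <- qs) q) a.
Proof.
elim: qs => [|q qs IHqs] qs2; first by rewrite big_nil size_poly1.
have q2 : (size q <= 2)%N by apply: qs2; rewrite mem_head.
rewrite big_cons => sz; have [sq|sq] := eqVneq (size q) 2%N.
  by have [a ra] := poly2_root sq; exists a; rewrite rootM ra.
have /size1_polyC qE : (size q <= 1)%N by rewrite -ltnS ltn_neqAle sq.
have [||a ra] := IHqs; last by exists a; rewrite rootM ra orbT.
  by move=> r rqs; apply: qs2; rewrite inE rqs orbT.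
  by apply: leq_trans sz _; rewrite qE mul_polyC size_scale_leq.
Qed.

Lemma split_quadratic (F : fieldType) (p : {poly F}) :
  split_poly p -> size p = 3%N ->
  exists k a b, p = k *: (('X - a%:P) * ('X - b%:P)).
Proof.
case=> qs qs2 pE p3.
have [|a] := prod_root qs2; first by rewrite -pE p3.
rewrite -pE => /factor_theorem[r rE].
have r2 : size r = 2%N.
  have r0 : r != 0 by apply: contra_eq_neq p3 => r0; rewrite rE r0 mul0r size_poly0.
  by move: p3; rewrite rE size_Mmonic ?monicXsubC // size_XsubC addn2 /= => -[].
have [b /factor_theorem[s sE]] := poly2_root r2.
have s1 : size s = 1%N.
  have s0 : s != 0 by apply: contra_eq_neq r2 => s0; rewrite sE s0 mul0r size_poly0.
  by move: r2; rewrite sE size_Mmonic ?monicXsubC // size_XsubC addn2 /= => -[].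
have /size1_polyC sC : (size s <= 1)%N by rewrite s1.
by exists s`_0, a, b; rewrite -mul_polyC -sC rE sE -mulrA [X in _ * X]mulrC.
Qed.

(** With [u = v + a], the product [(u - a) (u - b)] becomes [v (v - (b - a))]. *)
Lemma poly_end_split (F : fieldType) (V : lmodType F) (p : {poly F})
    (k a b : F) (u v : {linear V -> V}) :
  size p = 3%N -> p = k *: (('X - a%:P) * ('X - b%:P)) ->
  (forall x, u x = v x + a *: x) -> (forall x, v (v x) = (b - a) *: v x) ->
  poly_end p u =1 fun=> 0.
Proof.
move=> p3 pE uE vv x.
rewrite /poly_end p3 !big_ord_recl big_ord0 addr0 /=.
have pX : p = k *: 'X^2 - (k * (a + b)) *: 'X + (k * (a * b))%:P.
  rewrite pE mulrBl !mulrBr polyCM polyCM -!mul_polyC polyCM polyCD.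
  by rewrite expr2; ring.
have uu : u (u x) = (a + b) *: v x + (a * a) *: x.
  rewrite [u (u x)]uE uE (linearD v) [v (a *: x)]linearZ /= vv.
  by rewrite scalerDr scalerA addrA -!scalerDl; congr (_ *: _ + _); ring.
rewrite pX !coefE /= uu uE.
rewrite !scalerDr !scalerA addrACA -!scalerDl addrCA -scalerDl.
rewrite [X in X *: v x](_ : _ = 0) ?scale0r ?add0r; last by ring.
by rewrite [X in X *: x](_ : _ = 0) ?scale0r //; ring.
Qed.

Theorem theorem2 (F : fieldType) (p1 p2 p3 p4 : {poly F})
    (split1 : split_poly p1) (split2 : split_poly p2)
    (split3 : split_poly p3) (split4 : split_poly p4)
    (deg1 : size p1 = 3%N) (deg2 : size p2 = 3%N)
    (deg3 : size p3 = 3%N) (deg4 : size p4 = 3%N)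
    (V : lmodType F) (infV : infinite_dimensional V)
    (u : {linear V -> V}) :
  is_poly_sum [tuple p1; p2; p3; p4] u.
Proof.
have [k1 [a1 [b1 p1E]]] := split_quadratic split1 deg1.
have [k2 [a2 [b2 p2E]]] := split_quadratic split2 deg2.
have [k3 [a3 [b3 p3E]]] := split_quadratic split3 deg3.
have [k4 [a4 [b4 p4E]]] := split_quadratic split4 deg4.
have [v1 [v2 [v3 [v4 [[v1v v2v v3v v4v] uE]]]]] := sum_four_quadratic
  (b1 - a1) (b2 - a2) (b3 - a3) (b4 - a4)
  (u \- ((a1 + a2 + a3 + a4) \*: idfun)) infV.
pose us : 4.-tuple {linear V -> V} :=
  [tuple v1 \+ (a1 \*: idfun) : {linear V -> V};
         v2 \+ (a2 \*: idfun) : {linear V -> V};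
         v3 \+ (a3 \*: idfun) : {linear V -> V};
         v4 \+ (a4 \*: idfun) : {linear V -> V}].
exists (tnth us); split=> [x|].
  rewrite !big_ord_recl big_ord0 addr0 !(tnth_nth u) /=.
  move: (uE x) => /= /eqP; rewrite subr_eq => /eqP ->.
  by rewrite !scalerDl !addrA [LHS](ACl (1*5*2*6*3*7*4*8)).
case; do 4?[case=> [lt|]] => //; rewrite !(tnth_nth 0) !(tnth_nth u) /=.
- exact: poly_end_split deg1 p1E _ v1v.
- exact: poly_end_split deg2 p2E _ v2v.
- exact: poly_end_split deg3 p3E _ v3v.
- exact: poly_end_split deg4 p4E _ v4v.
Qed.
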